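(* For every compact abelian group $G$ and every finite set $D\subset G\setminus\{0\}$ with $|D|\le 3$, the Motzkin density $\mathrm{Md}_G(D)$ is a rational number.
   Context: Compact abelian groups are Hausdorff; $\mu$ denotes the Haar probability measure on $G$. For $D\subset G$, a set $A\subset G$ is $D$-avoiding if $(A-A)\cap D=\emptyset$. The Motzkin density is $\mathrm{Md}_G(D)=\sup\{\mu(A): A\subset G \text{ Borel},\ (A-A)\cap D=\emptyset\}$. *)

(* Defs.v *)
From HB Require Import structures.
From mathcomp Require Import all_boot all_order all_algebra.
From mathcomp Require Import all_classical all_reals all_analysis.
Set Implicit Arguments. Unset Strict Implicit. Unset Printing Implicit Defensive.
Import Order.TTheory GRing.Theory Num.Theory.
Local Open Scope classical_set_scope.
Local Open Scope ring_scope.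

Section BorelType.
Variable G : topologicalZmodType.
Definition borel_carrier : Type := G.
HB.instance Definition _ := Choice.on borel_carrier.
HB.instance Definition _ := isPointed.Build borel_carrier 0.
Definition borel_sets : set (set borel_carrier) := @open G.
HB.instance Definition _ :=
  Measurable.copy borel_carrier (g_sigma_algebraType borel_sets).
End BorelType.
Notation borel G := (borel_carrier G).
Lemma borel_measurableE (G : topologicalZmodType) :
  (measurable : set (set (borel G))) = <<s (@open G) >>.
Proof. by []. Qed.

Definition is_haar_prob (G : topologicalZmodType) (R : realType)
  (mu : probability (borel G) R) : Prop :=
  (forall (x : G) (A : set G), measurable (A : set (borel G)) ->
     mu ((fun y => x + y) @` A) = mu A) /\
  (forall A : set G, measurable (A : set (borel G)) ->
     mu A = ereal_sup [set mu K | K in [set K : set G | compact K /\ K `<=` A]]) /\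
  (forall A : set G, measurable (A : set (borel G)) ->
     mu A = ereal_inf [set mu U | U in [set U : set G | open U /\ A `<=` U]]).

Definition avoiding (G : zmodType) (D A : set G) : Prop :=
  forall a b, A a -> A b -> ~ D (a - b).

Definition motzkin_density (G : topologicalZmodType) (R : realType)
  (mu : probability (borel G) R) (D : set G) : \bar R :=
  ereal_sup [set mu A | A in [set A : set G |
                 measurable (A : set (borel G)) /\ avoiding D A]].

(* Main.v *)
Require Import Defs.
From HB Require Import structures.
From mathcomp Require Import all_boot all_order all_algebra.
From mathcomp Require Import zify ring lra.
From mathcomp Require Import all_classical all_reals all_analysis.
From mathcomp Require Import measurable_realfun.
Set Implicit Arguments.
Unset Strict Implicit.
Unset Printing Implicit Defensive.
Import Order.TTheory GRing.Theory Num.Theory.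
Local Open Scope classical_set_scope.
Local Open Scope ring_scope.

(** Let H be the subgroup generated by D.  The Motzkin density is the density of
    avoiding sets of H.  Indeed a bound on the number of elements that an
    avoiding set can have among finitely many translates integrates to an upper
    bound for its measure.  Conversely, avoiding sets of H are transplanted to G
    by region growing: by compactness G is covered by finitely many open sets C
    whose translates by a large ball of H are disjoint; around each point of C
    one keeps a ball whose boundary layer is small (possible since H has
    polynomial growth), fills it with a translate of the avoiding set, discards
    the layer, and goes on with the rest of G.

    It remains to see that the density is rational for H.  If the integer
    relations between the elements of D are all multiples of one relation v,
    then H maps onto the cycle of length N = |v|_1 and also contains a closed
    walk of length N, so the density is floor(N/2)/N (with N = 2 if there is no
    relation).  Otherwise, since D has at most three elements, two independent
    relations make all of D commensurable with one element t.  Then H is finite,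
    where the density is a maximum, or virtually cyclic, where it is the maximal
    mean weight of a cycle in a finite graph of states. *)

Lemma sumr_const_seq (V : nmodType) (I : Type) (s : seq I) (x : V) :
  \sum_(i <- s) x = x *+ size s.
Proof. by rewrite big_const_seq count_predT iter_addr_0. Qed.

(** * Cycles of maximal mean weight *)

Lemma nonuniq_split_loop (T : eqType) (s : seq T) : ~~ uniq s ->
  exists s1 y s2 s3, s = s1 ++ (y :: s2) ++ (y :: s3) /\ uniq (y :: s2).
Proof.
elim: s => //= a s IH; rewrite negb_and negbK.
have [us|/IH[s1 [y [s2 [s3 [-> u]]]]] _] := boolP (uniq s); last first.
  by exists (a :: s1), y, s2, s3.
rewrite orbF => /path.splitPr sE; case: sE us => s2 s3 us.
exists [::], a, s2, s3; split=> //.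
by move: us; rewrite cat_uniq /= negb_or => /and3P[-> /andP[-> _] _].
Qed.

Section WeightedCycles.
Variables (T : finType) (e : rel T).

Lemma path_sum_le (R : realDomainType) (w : T -> R) :
  (forall c, ucycle e c -> \sum_(y <- c) w y <= 0) ->
  forall x p, path e x p -> \sum_(y <- x :: p) w y <= \sum_y `|w y|.
Proof.
move=> cycle_le0 x p; have [k] := ubnP (size (x :: p)).
elim: k x p => // k IH x p; rewrite ltnS => size_p path_p.
have [uniq_p|] := boolP (uniq (x :: p)).
  rewrite (le_trans (ler_sum _ (fun y _ => ler_norm (w y)))) //.
  rewrite [leRHS](bigID (mem (x :: p))) /= (big_uniq _ uniq_p) lerDl.
  exact: sumr_ge0.
case/nonuniq_split_loop=> s1 [y [s2 [s3 [sE uniq_s2]]]].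
move: path_p; rewrite -[path _ _ _]/(sorted e (x :: p)) sE !sorted_cat_cons /=.
rewrite cat_path /= => /and4P[path_s1 path_s2 last_s2 path_s3].
have loop_le0 : \sum_(z <- y :: s2) w z <= 0.
  by apply: cycle_le0; rewrite /ucycle uniq_s2 /= rcons_path path_s2 last_s2.
have path_rest : sorted e (s1 ++ y :: s3).
  by rewrite sorted_cat_cons path_s1 path_s3.
rewrite big_cat -cat_cons big_cat /= addrCA -[leRHS]add0r lerD // -big_cat.
have : (size (s1 ++ y :: s3) < size (x :: p))%N.
  by rewrite sE !size_cat ltn_add2l /= ltnS leq_addl.
case: (s1 ++ y :: s3) path_rest => [|z q] path_q size_q.
  by rewrite big_nil sumr_ge0.
exact: IH (leq_trans size_q size_p) path_q.
Qed.

Section MeanWeight.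
Variables (R : realFieldType) (w : T -> R).

Definition mean_weight (c : seq T) : R := (\sum_(y <- c) w y) / (size c)%:R.

Lemma exists_max_mean_cycle c0 : c0 != [::] -> ucycle e c0 ->
  exists c, [/\ c != [::], ucycle e c &
    forall s, s != [::] -> ucycle e s -> mean_weight s <= mean_weight c].
Proof.
move=> c0_neq0 cycle_c0.
have size_lt (s : seq T) : uniq s -> (size s < #|T|.+1)%N.
  by move=> uniq_s; rewrite ltnS -(card_uniqP uniq_s) max_card.
pose sized_seq := {k : 'I_#|T|.+1 & k.-tuple T}.
pose pack (s : seq T) (uniq_s : uniq s) : sized_seq :=
  @Tagged _ (Ordinal (size_lt s uniq_s)) (fun k => k.-tuple T) (in_tuple s).
pose nontrivial_cycle (c : sized_seq) :=
  (tval (tagged c) != [::]) && ucycleb e (tagged c).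
have /andP[_ uniq_c0] := cycle_c0.
have pack_c0 : nontrivial_cycle (pack c0 uniq_c0) by apply/andP.
have [c /andP[c_neq0 cycle_c] c_max] :=
  arg_maxP (fun c : sized_seq => mean_weight (tagged c)) pack_c0.
exists (tval (tagged c)); split=> // s s_neq0 cycle_s.
have /andP[_ uniq_s] := cycle_s.
by apply: (c_max (pack s uniq_s)); apply/andP.
Qed.

Lemma path_sum_le_mean c0 : c0 != [::] -> ucycle e c0 ->
  exists c C, [/\ c != [::], cycle e c &
    forall x p, path e x p ->
      \sum_(y <- x :: p) w y <= mean_weight c * (size (x :: p))%:R + C].
Proof.
move=> c0_neq0 /(exists_max_mean_cycle c0_neq0)[c [c_neq0 cycle_c c_max]].
have sum_sub_mean s : \sum_(y <- s) (w y - mean_weight c) =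
    \sum_(y <- s) w y - mean_weight c * (size s)%:R.
  by rewrite sumrB sumr_const_seq mulr_natr.
exists c, (\sum_y `|w y - mean_weight c|); split=> // [|x p path_p].
  by case/andP: cycle_c.
rewrite addrC -lerBlDr -sum_sub_mean; apply: path_sum_le path_p => s cycle_s.
have [->|s_neq0] := eqVneq s [::]; first by rewrite big_nil.
by rewrite sum_sub_mean subr_le0 -ler_pdivrMr ?ltr0n ?lt0n ?size_eq0 ?c_max.
Qed.
End MeanWeight.
End WeightedCycles.

(** * Translates and integer combinations *)

Section Translates.
Variable G : zmodType.
Implicit Types (A D : set G) (gs : seq G) (x y t : G).

Definition translate x A : set G := [set y | A (y - x)].

Lemma mem_translate x y A : (y \in translate x A) = (y - x \in A).
Proof. by []. Qed.

Lemma avoiding_translate D A x : avoiding D A -> avoiding D (translate x A).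
Proof. by move=> avA a b /avA/[apply]; rewrite opprB addrA subrK. Qed.

Definition hits A gs x : nat := (\sum_(g <- gs) ((x + g)%R \in A))%N.

Lemma hits_translate A gs x y : hits (translate y A) gs x = hits A gs (x - y).
Proof. by apply: eq_bigr => g _; rewrite mem_translate addrAC. Qed.

Lemma hits_le_size A gs x : (hits A gs x <= size gs)%N.
Proof. by rewrite -sum1_size; apply: leq_sum => g _; exact: leq_b1. Qed.

Section Invariance.
Variables (R : Type) (F : G -> R).

Lemma invariant_intmul t : (forall x, F (x + t) = F x) ->
  forall (z : int) x, F (x + t *~ z) = F x.
Proof.
move=> Ft; elim/int_ind => [|n IH|n IH] x.
- by rewrite mulr0z addr0.
- by rewrite intS mulrzDr mulr1z addrA IH Ft.
- by rewrite intS opprD mulrzDr mulrNz mulr1z addrA IH -[LHS]Ft subrK.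
Qed.

Lemma big_period_shift (idx : R) (op : Monoid.com_law idx) t N :
  (forall x, F (x + t *+ N) = F x) -> forall x,
  \big[op/idx]_(0 <= i < N) F (x + t + t *+ i) =
  \big[op/idx]_(0 <= i < N) F (x + t *+ i).
Proof.
case: N => [|N] FN x; first by rewrite !big_geq.
rewrite big_nat_recr //= [RHS]big_nat_recl //= Monoid.mulmC.
rewrite -addrA -mulrS FN mulr0n addr0; congr (op _ _).
by apply: eq_bigr => i _; rewrite mulrS addrA.
Qed.
End Invariance.
End Translates.

Section Combinations.
Variables (G : zmodType) (n : nat).
Implicit Types (d : 'I_n -> G) (v w : 'rV[int]_n).

Definition comb d v : G := \sum_i d i *~ v 0 i.

Lemma comb_is_zmod_morphism d : {morph comb d : v w / v - w}.
Proof.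
move=> v w; rewrite /comb -sumrB; apply: eq_bigr => i _.
by rewrite !mxE mulrzBr.
Qed.

HB.instance Definition _ d :=
  GRing.isZmodMorphism.Build _ _ (comb d) (comb_is_zmod_morphism d).

Lemma combZ d a v : comb d (a *: v) = comb d v *~ a.
Proof. by rewrite -[a in LHS]intz scaler_int raddfMz. Qed.

Lemma comb_delta d i : comb d (delta_mx 0 i) = d i.
Proof.
rewrite /comb (bigD1 i) //= big1 ?addr0 => [|j /negbTE ij]; rewrite mxE.
  by rewrite !eqxx.
by rewrite ij andbF.
Qed.

Lemma invariant_comb (R : Type) (F : G -> R) d :
  (forall i x, F (x + d i) = F x) -> forall v x, F (x + comb d v) = F x.
Proof.
move=> Fd; rewrite /comb => v; elim/big_ind: _ => [x|y z Fy Fz x|i _ x].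
- by rewrite addr0.
- by rewrite addrA Fz Fy.
- exact: invariant_intmul.
Qed.
End Combinations.

Lemma comb_mulrn (G : zmodType) n (d : 'I_n -> G) (l : 'I_n -> int) (t : G) N
    v :
  (forall i, d i *+ N = t *~ l i) -> comb d v *+ N = t *~ comb l v.
Proof.
move=> dN; rewrite raddf_sum -sumrMnl; apply: eq_bigr => i _.
by rewrite /= pmulrn mulrzAC -pmulrn dN mulrzz mulrzA.
Qed.

(** * Densities along a finitely generated subgroup *)

Section AvoidingDensity.
Variable G : zmodType.

(* The lower bound exhibits one pattern P that fills every translate of a window
   gs by the subgroup generated by d.  The upper bound tests all avoiding sets
   of G on all translates of a window, so cosets need not be singled out. *)
Definition avoiding_density_ge n (d : 'I_n -> G) (q : rat) : Prop :=
  exists P gs, [/\ avoiding (range d) P, gs != [::] &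
    forall v, q * (size gs)%:R <= (hits P gs (comb d v))%:R].

Definition avoiding_density_le (D : set G) (q : rat) : Prop :=
  forall e, 0 < e -> exists2 gs, gs != [::] &
    forall A x, avoiding D A -> (hits A gs x)%:R <= (q + e) * (size gs)%:R.

Definition avoiding_density n (d : 'I_n -> G) (q : rat) : Prop :=
  avoiding_density_ge d q /\ avoiding_density_le (range d) q.

Lemma avoiding_density_exact n (d : 'I_n -> G) P gs gs' c :
  gs != [::] -> size gs' = size gs -> avoiding (range d) P ->
  (forall v, (c <= hits P gs (comb d v))%N) ->
  (forall A x, avoiding (range d) A -> (hits A gs' x <= c)%N) ->
  avoiding_density d (c%:R / (size gs)%:R).
Proof.
move=> gs_neq0 size_gs' avP c_le hits_le.
have size_neq0 : (size gs)%:R != 0 :> rat by rewrite pnatr_eq0 size_eq0.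
split; first by exists P, gs; split=> // v; rewrite divfK // ler_nat.
move=> e e_gt0; exists gs' => [|A x avA].
  by rewrite -size_eq0 size_gs' size_eq0.
rewrite size_gs' mulrDl divfK // ler_wpDr ?mulr_ge0 ?(ltW e_gt0) //.
by rewrite ler_nat hits_le.
Qed.
End AvoidingDensity.

Section Cube.
Variables (n N : nat).
Hypothesis N_gt0 : (0 < N)%N.

Definition cube_point (k : {ffun 'I_n -> 'I_N}) : 'rV[int]_n :=
  \row_i (k i)%:Z.

Lemma big_cube_shift (R : Type) (idx : R) (op : Monoid.com_law idx)
    (F : 'rV[int]_n -> R) : (forall v w, F (v + w *+ N) = F v) -> forall v,
  \big[op/idx]_k F (v + cube_point k) = \big[op/idx]_k F (cube_point k).
Proof.
move=> FN v.
have N_neq0 : N%:Z != 0 by rewrite eqz_nat -lt0n.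
have residue_lt (z : int) : (`|(z %% N)%Z| < N)%N.
  by rewrite -ltz_nat abszE ger0_norm ?modz_ge0 ?ltz_pmod.
pose residue (w : 'rV[int]_n) := [ffun i => Ordinal (residue_lt (w 0 i))].
have residueE w i : (residue w i)%:Z = (w 0%R i %% N)%Z.
  by rewrite ffunE /= abszE ger0_norm ?modz_ge0.
have F_residue w : F w = F (cube_point (residue w)).
  rewrite -[RHS](FN _ (\row_i (w 0%R i %/ N)%Z)); congr F; apply/rowP => i.
  by rewrite !mxE residueE mulmxnE mxE {1}(divz_eq (w 0 i) N); ring.
have residue_inj : injective (fun k => residue (v + cube_point k)).
  move=> k k' /ffunP kk'; apply/ffunP => i; apply/val_inj.
  have /eqP : ((v + cube_point k) 0%R i = (v + cube_point k') 0%R i %[mod N])%Z.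
    by rewrite -!residueE kk'.
  by rewrite !mxE eqz_modDl !modz_nat !modn_small ?ltn_ord // eqz_nat => /eqP.
rewrite [RHS](reindex_inj residue_inj); apply: eq_bigr => k _.
exact: F_residue.
Qed.

Lemma big_box_shift (G : zmodType) (d : 'I_n -> G) (R : Type) (idx : R)
    (op : Monoid.com_law idx) (F : G -> R) :
  (forall i x, F (x + d i *+ N) = F x) -> forall v,
  \big[op/idx]_k F (comb d v + comb d (cube_point k)) =
  \big[op/idx]_k F (comb d (cube_point k)).
Proof.
move=> FdN v.
have FN w u : F (comb d (w + u *+ N)) = F (comb d w).
  have -> : comb d (w + u *+ N) = comb d w + comb (fun i => d i *+ N) u.
    rewrite raddfD raddfMn; congr (_ + _).
    rewrite /comb -sumrMnl; apply: eq_bigr => i _.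
    by rewrite !pmulrn mulrzAC.
  exact: invariant_comb.
rewrite -(big_cube_shift op FN v); apply: eq_bigr => k _.
by rewrite raddfD.
Qed.
End Cube.

Lemma avoiding_density_torsion (G : zmodType) n (d : 'I_n -> G) N :
  (0 < N)%N -> (forall i, d i *+ N = 0) -> exists q, avoiding_density d q.
Proof.
move=> N_gt0 dN.
pose box := [seq comb d (cube_point k) | k : {ffun 'I_n -> 'I_N}].
pose attained c := `[< exists2 A, avoiding (range d) A & hits A box 0 = c >].
have ex_attained : exists c, attained c.
  by exists (hits set0 box 0); apply/asboolP; exists set0 => // a b [].
have attained_le c : attained c -> (c <= size box)%N.
  by move=> /asboolP[A _ <-]; exact: hits_le_size.
have [c /asboolP[P avP hitsP] c_max] := ex_maxnP ex_attained attained_le.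
exists (c%:R / (size box)%:R); apply: (avoiding_density_exact (P := P)) => //.
- by rewrite -size_eq0 size_image card_ffun !card_ord -lt0n expn_gt0 N_gt0.
- move=> v; rewrite -hitsP /hits !big_image /=.
  rewrite (big_box_shift N_gt0 addn (F := fun x => nat_of_bool (x \in P))).
    by apply/eq_leq/eq_bigr => k _; rewrite add0r.
  by move=> i x; rewrite dN addr0.
- move=> A x avA; apply: c_max; apply/asboolP.
  exists (translate (- x) A); first exact: avoiding_translate.
  by rewrite hits_translate sub0r opprK.
Qed.

(** * Relations of rank at most one *)

Definition walk (G : zmodType) (steps : seq G) : seq G :=
  [seq \sum_(s <- take k steps) s | k <- iota 0 (size steps)].

Lemma closed_walk_hits (G : zmodType) (D A : set G) (steps : seq G) x :
  (forall s, s \in steps -> D s \/ D (- s)) -> \sum_(s <- steps) s = 0 ->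
  avoiding D A -> (hits A (walk steps) x <= (size steps)./2)%N.
Proof.
move=> stepsD steps0 avA.
pose vertex k := x + \sum_(s <- take k steps) s.
pose visit k := nat_of_bool (vertex k \in A).
have vertexS k : (k < size steps)%N -> vertex k.+1 = vertex k + nth 0 steps k.
  by move=> k_lt; rewrite /vertex (take_nth 0) // big_rcons addrA.
have visitD k : (k < size steps)%N -> (visit k + visit k.+1 <= 1)%N.
  move=> k_lt; rewrite /visit vertexS //.
  have [/set_mem Ak|_] := boolP (vertex k \in A); last exact: leq_b1.
  have [/set_mem AkS|//] := boolP (_ \in A); exfalso.
  case: (stepsD _ (mem_nth 0 k_lt)) => Ds.
    by apply: (avA _ _ AkS Ak); rewrite addrC addKr.
  by apply: (avA _ _ Ak AkS); rewrite opprD addrA subrr add0r.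
have visit_closed : (\sum_(0 <= k < size steps) visit k.+1 =
                     \sum_(0 <= k < size steps) visit k)%N.
  have := @big_nat_recr _ 0%N addn (size steps) 0 visit (leq0n _).
  rewrite big_nat_recl // /visit /vertex take0 take_size steps0 big_nil /=.
  by rewrite addnC => /addIn.
have -> : hits A (walk steps) x = (\sum_(0 <= k < size steps) visit k)%N.
  by rewrite /hits big_map /index_iota subn0.
rewrite geq_half_double -addnn -[X in (_ + X)%N]visit_closed -big_split /=.
rewrite -[leqRHS]subn0 -[leqRHS]muln1 -sum_nat_const_nat.
by rewrite big_nat [leqRHS]big_nat; apply: leq_sum => k /andP[_ /visitD].
Qed.

Definition even_residues (N : nat) : set int :=
  [set z | ~~ odd `|(z %% N)%Z| /\ (`|(z %% N)%Z|.+1 < N)%N].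

Lemma avoiding_even_residues (N : nat) (e : int) : `|e| = 1 ->
  avoiding [set z | (N %| z - e)%Z] (even_residues N).
Proof.
move=> e_unit y z [even_y y_lt] [even_z z_lt] /dvdzP[c cE].
have N_neq0 : N%:Z != 0 by rewrite eqz_nat; case: (N) y_lt.
have residueE (u : int) : u = (u %/ N)%Z * N%:Z + `|(u %% N)%Z|%N.
  by rewrite abszE ger0_norm ?modz_ge0 // -divz_eq.
move: even_y even_z y_lt z_lt (residueE y) (residueE z).
move: `|(y %% N)%Z|%N `|(z %% N)%Z|%N (y %/ N)%Z (z %/ N)%Z => r s a b.
move=> even_r even_s r_lt s_lt yE zE.
have quotE : (c - a + b) * N%:Z = r%:Z - s%:Z - e by lia.
have quot0 : c - a + b = 0 by nia.
by rewrite quot0 mul0r in quotE; lia.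
Qed.

Lemma even_residues_window (N : nat) (z : int) : (1 < N)%N ->
  (N./2 <= \sum_(0 <= k < N) ((z + k%:Z)%R \in even_residues N))%N.
Proof.
move=> N_gt1.
pose even (y : int) := nat_of_bool (y \in even_residues N).
have evenN y : even (y + 1 *+ N) = even y.
  rewrite /even; congr nat_of_bool; apply/asbool_equiv_eq.
  by rewrite /even_residues /= natz modzDr.
pose window y := (\sum_(0 <= k < N) even (y + 1 *+ k)%R)%N.
have windowS y : window (y + 1) = window y by exact: (big_period_shift addn).
have -> : (\sum_(0 <= k < N) ((z + k%:Z)%R \in even_residues N) = window 0)%N.
  rewrite -(invariant_intmul windowS z 0) add0r intz.
  by apply: eq_bigr => k _; rewrite natz.
have : (N./2 <= \sum_(0 <= k < N) (~~ odd k && (k.+1 < N)))%N.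
  case: (N) N_gt1 => // M _; rewrite big_nat_recr //= ltnn andbF addn0.
  rewrite (eq_big_nat _ _ (F2 := fun k => nat_of_bool (~~ odd k))); last first.
    by move=> k /andP[_ kM]; rewrite ltnS kM andbT.
  elim: M => [|M IH]; first by rewrite big_geq.
  by rewrite big_nat_recr //=; lia.
move=> /leq_trans; apply; rewrite big_nat [leqRHS]big_nat.
apply: leq_sum => k /andP[_ kN]; rewrite /even add0r natz.
case: andP => // -[even_k kS_lt].
by rewrite mem_set //; split; rewrite modz_nat absz_nat modn_small.
Qed.

Lemma avoiding_density_cycle (G : zmodType) n (d : 'I_n -> G)
    (e : 'I_n -> int) (steps : seq G) :
  (1 < size steps)%N -> (forall i, `|e i| = 1) ->
  (forall v, comb d v = 0 -> (size steps %| comb e v)%Z) ->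
  (forall s, s \in steps -> range d s \/ range d (- s)) ->
  \sum_(s <- steps) s = 0 ->
  avoiding_density d ((size steps)./2%:R / (size steps)%:R).
Proof.
set N := size steps => N_gt1 e_unit dvd_comb stepsD steps0.
have [i] : exists i : 'I_n, True.
  move: N_gt1 stepsD; rewrite /N; case: (steps) => [//|s ss _].
  by case/(_ s (mem_head _ _)) => -[i]; exists i.
pose gs := [seq d i *~ (e i * k%:Z) | k <- iota 0 N].
have size_gs : size gs = N by rewrite size_map size_iota.
rewrite -{2}size_gs => _; apply: (avoiding_density_exact (gs' := walk steps)
  (P := comb d @` (comb e @^-1` even_residues N))).
- by rewrite -size_eq0 size_gs -lt0n ltnW.
- by rewrite size_gs /walk size_map size_iota.
- move=> _ _ [v even_v <-] [w even_w <-] [j _ djE].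
  have /dvd_comb : comb d (v - w - delta_mx 0 j) = 0.
    by rewrite !raddfB /= comb_delta djE subrr.
  rewrite !raddfB /= comb_delta.
  exact: (avoiding_even_residues (e_unit j)) even_v even_w.
- move=> v; apply: leq_trans (even_residues_window (comb e v) N_gt1) _.
  rewrite /hits big_map /index_iota subn0; apply: leq_sum => k _.
  case: (boolP (_ \in even_residues N)) => // /set_mem even_vk.
  rewrite mem_set //; exists (v + (e i * k%:Z) *: delta_mx 0 i).
    have ei2 : e i * e i = 1.
      by rewrite -expr2 -real_normK ?num_real // e_unit expr1n.
    by rewrite /preimage /= raddfD /= combZ comb_delta mulrzz mulrA ei2 mul1r.
  by rewrite raddfD /= combZ comb_delta.
- by move=> A x avA; exact: closed_walk_hits stepsD steps0 avA.
Qed.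

Definition parallel n (u v : 'rV[int]_n) : Prop :=
  forall i j, u 0 i * v 0 j = u 0 j * v 0 i.

Lemma cyclic_of_parallel n (L : {pred 'rV[int]_n}) :
  submod_closed L -> {in L &, forall u v, parallel u v} ->
  exists2 v, v \in L & {in L, forall w, exists q : int, w = q *: v}.
Proof.
move=> [L0 L_lin] L_par.
have [[u uL u_neq0]|L_eq0] := pselect (exists2 u, u \in L & u != 0); last first.
  exists 0 => // w wL; exists 0; rewrite scale0r.
  by apply/eqP/negP => /negP w_neq0; apply: L_eq0; exists w.
have /rV0Pn[i ui_neq0] := u_neq0.
pose attained k := `[< exists2 v, v \in L & v 0 i != 0 /\ `|v 0%R i|%N = k >].
have ex_attained : exists k, attained k.
  by exists `|u 0%R i|%N; apply/asboolP; exists u.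
have [_ /asboolP[v vL [vi_neq0 <-]] v_min] := ex_minnP ex_attained.
exists v => // w wL; exists (w 0%R i %/ v 0%R i)%Z.
pose r := - (w 0%R i %/ v 0%R i)%Z *: v + w.
have rL : r \in L by exact: L_lin.
have ri : r 0 i = (w 0%R i %% v 0%R i)%Z by rewrite !mxE /modz; ring.
have ri_eq0 : r 0 i = 0.
  apply/eqP/negP => /negP ri_neq0.
  have /v_min : attained `|r 0%R i|%N by apply/asboolP; exists r.
  rewrite leqNgt -ltz_nat !abszE ri ger0_norm ?modz_ge0 //.
  by rewrite ltz_mod.
apply/esym/eqP; rewrite -subr_eq0 -oppr_eq0 opprB addrC -scaleNr -/r.
apply/eqP/rowP => j; rewrite [RHS]mxE; apply/eqP.
have /eqP := L_par _ _ rL vL i j.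
by rewrite ri_eq0 mul0r eq_sym mulf_eq0 (negbTE vi_neq0) orbF.
Qed.

Section RelationWalk.
Variables (G : zmodType) (n : nat) (d : 'I_n -> G).
Implicit Type v : 'rV[int]_n.

Definition relation_steps v : seq G :=
  flatten [seq nseq `|v 0%R i|%N (d i *~ (-1) ^+ (v 0 i < 0)%R) | i : 'I_n].

Lemma size_relation_steps v :
  size (relation_steps v) = (\sum_i `|v 0%R i|)%N.
Proof.
rewrite size_flatten /shape sumnE big_map big_image /=.
by apply: eq_bigr => i _; rewrite size_nseq.
Qed.

Lemma sum_relation_steps v : \sum_(s <- relation_steps v) s = comb d v.
Proof.
rewrite big_flatten big_image; apply: eq_bigr => i _ /=.
by rewrite big_nseq iter_addr_0 pmulrn -mulrzA abszE mulr_sign_norm.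
Qed.

Lemma mem_relation_steps v s :
  s \in relation_steps v -> range d s \/ range d (- s).
Proof.
move=> /flatten_mapP[i _]; rewrite mem_nseq => /andP[_ /eqP ->].
by case: (v 0 i < 0)%R; [right|left]; exists i; rewrite ?expr1 ?mulrNz ?opprK.
Qed.

Lemma size_relation_gt1 v :
  (forall i, d i != 0) -> v != 0 -> comb d v = 0 -> (1 < \sum_i `|v 0%R i|)%N.
Proof.
move=> d_neq0 /rV0Pn[i vi_neq0] v_rel; rewrite ltnNge; apply/negP.
have := vi_neq0; rewrite -absz_gt0 (bigD1 i) //= => vi_gt0 size_le1.
have vi1 : `|v 0%R i|%N = 1%N by lia.
have v0 j : j != i -> v 0 j = 0.
  move: size_le1; rewrite vi1 -[leqRHS]addn0 leq_add2l leqn0.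
  by rewrite sum_nat_eq0 => /forall_inP/(_ j)/[apply]; rewrite absz_eq0 => /eqP.
have /negP := d_neq0 i; apply.
move: v_rel; rewrite /comb (bigD1 i) //= big1 => [|j /v0 ->]; last first.
  by rewrite mulr0z.
rewrite addr0; have [->|->] : v 0 i = 1 \/ v 0 i = -1 by lia.
  by rewrite mulr1z => ->.
by rewrite mulrN1z => /eqP; rewrite oppr_eq0.
Qed.
End RelationWalk.

Lemma avoiding_density_parallel (G : zmodType) n (d : 'I_n.+1 -> G) :
  (forall i, d i != 0) ->
  (forall u v, comb d u = 0 -> comb d v = 0 -> parallel u v) ->
  exists q, avoiding_density d q.
Proof.
move=> d_neq0 d_par.
have [||v /eqP v_rel v_gen] :=
    @cyclic_of_parallel _ [pred v | comb d v == 0].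
- split=> [|a u v /eqP u0 /eqP v0]; rewrite inE; first by rewrite raddf0.
  by rewrite raddfD /= combZ u0 v0 mul0rz addr0.
- by move=> u v /eqP u0 /eqP v0; exact: d_par.
have {}v_gen w : comb d w = 0 -> exists q, w = q *: v by move/eqP/v_gen.
have [v0|v_neq0] := eqVneq v 0.
  exists (1 / 2%:R).
  apply: (@avoiding_density_cycle _ _ _ (fun=> 1) [:: d ord0; - d ord0]) => //.
  - by move=> w /v_gen[q ->]; rewrite v0 scaler0 raddf0.
  - move=> s; rewrite !inE => /orP[] /eqP->; [left|right];
      by rewrite ?opprK; exists ord0.
  - by rewrite big_cons big_seq1 subrr.
exists ((size (relation_steps d v))./2%:R / (size (relation_steps d v))%:R).
apply: (@avoiding_density_cycle _ _ _ (fun i => (-1) ^+ (v 0 i < 0)%R)).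
- by rewrite size_relation_steps (size_relation_gt1 d_neq0).
- by move=> i; rewrite normr_sign.
- move=> w /v_gen[q ->]; rewrite combZ size_relation_steps.
  apply/dvdzP; exists q; rewrite mulrzz mulrC; congr (_ * _).
  rewrite /comb (big_morph Posz PoszD (erefl _)); apply: eq_bigr => i _.
  by rewrite mulrzz -normrEsign abszE.
- by move=> s; exact: mem_relation_steps.
- by rewrite sum_relation_steps.
Qed.

(** * Virtually cyclic subgroups *)

Section BlockStates.
Variables (G : zmodType) (D : set G) (I : finType) (cell : I -> G) (t : G).
Implicit Types (A : set G) (i j : I) (z : int).

Definition state A : {set I} := [set i | cell i \in A]%SET.

Definition state_step : rel {set I} := fun s s' =>
  `[< exists2 A, avoiding D A &
        state A = s /\ state (translate (- t) A) = s' >].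

Lemma card_state A : #|state A| = (\sum_i (cell i \in A))%N.
Proof.
by rewrite -sum1_card big_mkcond; apply: eq_bigr => i _; rewrite inE.
Qed.

Lemma path_state A k m : avoiding D A ->
  path state_step (state (translate (- (t *+ k)) A))
    [seq state (translate (- (t *+ l)) A) | l <- iota k.+1 m].
Proof.
move=> avA; elim: m k => //= m IH k; rewrite {}IH andbT.
apply/asboolP; exists (translate (- (t *+ k)) A).
  exact: avoiding_translate.
split=> //; apply/setP => i; rewrite !inE !mem_translate !opprK.
by rewrite mulrS addrA.
Qed.

Definition blocks L : seq G :=
  [seq cell i + t *+ k | k <- iota 0 L, i <- enum I].

Lemma size_blocks L : size (blocks L) = (L * #|I|)%N.
Proof. by rewrite size_allpairs size_iota -cardE. Qed.

Lemma hits_blocks A L x : hits A (blocks L) x =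
  (\sum_(k <- iota 0 L)
     #|state (translate (- (t *+ k)) (translate (- x) A))|)%N.
Proof.
rewrite /hits big_allpairs_dep; apply: eq_bigr => k _.
rewrite card_state big_enum; apply: eq_bigr => i _.
by rewrite !mem_translate !opprK addrC addrAC.
Qed.

Definition mean_card (c : seq {set I}) : rat :=
  mean_weight (fun s : {set I} => #|s|%:R) c.

Lemma avoiding_density_le_mean_card : (0 < #|I|)%N ->
  exists c, [/\ c != [::], cycle state_step c &
    avoiding_density_le D (mean_card c / #|I|%:R)].
Proof.
move=> I_gt0.
have loop0 : ucycle state_step [:: state set0].
  by rewrite /ucycle /= !andbT; apply/asboolP; exists set0 => // a b [].
have [c [C [c_neq0 cycle_c path_le]]] :=
  path_sum_le_mean (fun s : {set I} => #|s|%:R : rat) (isT : [:: _] != [::])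
    loop0.
exists c; split=> // e e_gt0; rewrite /mean_card.
set q := mean_weight _ c in path_le *.
have card_gt0 : 0 < #|I|%:R :> rat by rewrite ltr0n.
pose L := (Num.bound (`|C| / (e * #|I|%:R))).+1.
have C_le : C <= e * #|I|%:R * L%:R.
  apply: le_trans (ler_norm C) _; rewrite mulrC -ler_pdivrMr ?mulr_gt0 //.
  rewrite (le_trans (ltW (archi_boundP _))) ?ler_nat //.
  by rewrite divr_ge0 // mulr_ge0 // ltW.
exists (blocks L) => [|A x avA].
  by rewrite -size_eq0 size_blocks -lt0n muln_gt0.
have path_A := path_state 0 L.-1 (avoiding_translate (x := - x) avA).
have {path_le} := path_le _ _ path_A.
rewrite -[_ :: _]/(map (fun k => state (translate (- (t *+ k)) _)) (iota 0 L)).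
rewrite big_map size_map size_iota hits_blocks size_blocks natr_sum natrM.
move=> /le_trans; apply.
have -> : (q / #|I|%:R + e) * (L%:R * #|I|%:R) = q * L%:R + e * #|I|%:R * L%:R.
  by field; rewrite gt_eqF.
by rewrite lerD2l.
Qed.

Variable sig : int -> {set I}.
Hypothesis step_sig : forall z, state_step (sig z) (sig (z + 1)).
Hypothesis cell_block_inj : forall i j z z',
  cell i + t *~ z = cell j + t *~ z' -> z = z'.
Hypothesis cell_local : forall i j z z',
  D ((cell i + t *~ z) - (cell j + t *~ z')) ->
  [\/ z = z', z = z' + 1 | z' = z + 1].

Definition glued : set G :=
  [set x | exists i z, x = cell i + t *~ z /\ i \in sig z].

(* D only links cells of the same or of neighbouring blocks, so that avoidance
   can be checked on windows of two blocks, where glued agrees with some A. *)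
Lemma glued_window z : exists2 A, avoiding D A &
  forall i z', z' = z \/ z' = z + 1 ->
    (cell i + t *~ z' \in A) = (i \in sig z').
Proof.
have /asboolP[A avA [sE s'E]] := step_sig z.
exists (translate (t *~ z) A); first exact: avoiding_translate.
move=> i z' [->|->]; rewrite mem_translate.
  by rewrite addrK -sE inE.
by rewrite -s'E inE mem_translate opprK mulrzDr mulr1z addrA addrAC addrK.
Qed.

Lemma mem_glued i z : (cell i + t *~ z \in glued) = (i \in sig z).
Proof.
have [A _ mem_A] := glued_window z.
apply/idP/idP => [/set_mem[j [z' [E]]]|iz]; last first.
  by apply/mem_set; exists i, z.
have zz' := cell_block_inj E; rewrite -zz' in E *.
by rewrite -!(mem_A _ z (or_introl erefl)) E.
Qed.

Lemma avoiding_glued : avoiding D glued.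
Proof.
move=> _ _ [i [z [-> iz]]] [j [z' [-> jz']]] Dij.
have [y zy z'y] : exists2 y, z = y \/ z = y + 1 & z' = y \/ z' = y + 1.
  by case: (cell_local Dij) => E; [exists z|exists z'|exists z]; auto.
have [A avA mem_A] := glued_window y.
by apply: (avA _ _ _ _ Dij); apply: set_mem; rewrite mem_A.
Qed.

Lemma glued_periodic p : (forall z, sig (z + p%:Z) = sig z) ->
  forall x, (x + t *+ p \in glued) = (x \in glued).
Proof.
move=> sig_p x; apply/idP/idP => /set_mem[k [z [E kz]]]; apply/mem_set.
  exists k, (z - p%:Z); split; last by rewrite -sig_p subrK.
  by rewrite mulrzBr addrA -E -pmulrn addrK.
exists k, (z + p%:Z); split; last by rewrite sig_p.
by rewrite mulrzDr addrA -E pmulrn.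
Qed.
End BlockStates.

Lemma cycle_nth_modz (T : Type) (e : rel T) (c : seq T) x0 :
  cycle e c -> c <> [::] -> forall z : int,
  e (nth x0 c `|(z %% size c)%Z|) (nth x0 c `|((z + 1) %% size c)%Z|).
Proof.
case: c => // a c cyc _ z; set p := size (a :: c).
have -> : ((z + 1) %% p)%Z = (((z %% p)%Z + 1) %% p)%Z by rewrite modzDml.
have : (z %% p)%Z < p%:Z by rewrite ltz_pmod.
case: (z %% p)%Z (modz_ge0 z (isT : p%:Z != 0)) => [r|//] _.
rewrite ltz_nat => r_lt.
rewrite -[1]/(1%:Z) -PoszD modz_nat !absz_nat addn1.
have := (pathP x0 cyc) r; rewrite size_rcons => /(_ r_lt).
rewrite -rcons_cons !nth_rcons r_lt /=.
have [rc|rc|->] := ltngtP r (size c); last by rewrite modnn.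
  by rewrite modn_small.
by move: r_lt; rewrite /p /= ltnS leqNgt rc.
Qed.

Section VirtuallyCyclic.
Variables (G : zmodType) (n N : nat) (d : 'I_n -> G) (l : 'I_n -> int) (t : G).
Hypothesis N_gt0 : (0 < N)%N.
Hypothesis t_free : forall z : int, t *~ z = 0 -> z = 0.
Hypothesis d_level : forall i, d i *+ N = t *~ l i.
Hypothesis l_le : forall i, `|l i| <= N%:Z.
Let I := {ffun 'I_n -> 'I_N}.

(* The level comb l v / N of comb d v grows by 1 along t.  Every point of the
   box is moved back by the integer part of its level, hence to [0, 1). *)
Definition cell (k : I) : G :=
  comb d (cube_point k) - t *~ (comb l (cube_point k) %/ N)%Z.

Lemma cell_level k : exists2 r : int, 0 <= r < N%:Z &
  forall z, (cell k + t *~ z) *+ N = t *~ (r + N%:Z * z).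
Proof.
exists (comb l (cube_point k) %% N)%Z => [|z].
  by rewrite modz_ge0 ?ltz_pmod //; lia.
rewrite !mulrnDl mulNrn (comb_mulrn _ d_level) !pmulrn -!mulrzA.
rewrite -mulrzBr -mulrzDr.
by congr (t *~ _); rewrite {1}(divz_eq (comb l (cube_point k)) N); ring.
Qed.

Lemma intmul_free_inj : injective (intmul t).
Proof. by move=> y z E; apply/subr0_eq/t_free; rewrite mulrzBr E subrr. Qed.

Lemma cell_block_inj i j z z' : cell i + t *~ z = cell j + t *~ z' -> z = z'.
Proof.
have [r r_lt rE] := cell_level i; have [s s_lt sE] := cell_level j.
move=> /(congr1 (fun x => x *+ N)); rewrite rE sE => /intmul_free_inj; nia.
Qed.

Lemma cell_local i j z z' :
  range d ((cell i + t *~ z) - (cell j + t *~ z')) ->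
  [\/ z = z', z = z' + 1 | z' = z + 1].
Proof.
have [r r_lt rE] := cell_level i; have [s s_lt sE] := cell_level j.
case=> k _ /(congr1 (fun x => x *+ N)).
rewrite mulrnBl rE sE d_level -mulrzBr => /intmul_free_inj => E.
have lk := l_le k.
have [] : (z = z' \/ z = z' + 1) \/ z' = z + 1 by nia.
  by case; [constructor 1|constructor 2].
by constructor 3.
Qed.

Definition box_progression p : seq G :=
  [seq comb d (cube_point k) + t *+ i | k <- enum {: I}, i <- iota 0 p].

Lemma size_box_progression p : size (box_progression p) = (#|{: I}| * p)%N.
Proof. by rewrite size_allpairs size_iota -cardE. Qed.

Lemma hits_box_progression (P : set G) p v :
  (forall x, (x + t *+ p \in P) = (x \in P)) ->
  hits P (box_progression p) (comb d v) =
  (\sum_(0 <= i < p) \sum_(k : I) ((cell k + t *+ i)%R \in P))%N.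
Proof.
move=> P_periodic.
pose F x := (\sum_(0 <= i < p) ((x + t *+ i)%R \in P))%N.
have F_invariant : forall z x, F (x + t *~ z) = F x.
  apply: invariant_intmul => x.
  by apply: (big_period_shift addn (F := fun y => nat_of_bool (y \in P))) => y;
    rewrite P_periodic.
rewrite exchange_big /=.
transitivity (\sum_(k : I) F (comb d (cube_point k)))%N.
  rewrite -(big_box_shift N_gt0 addn (d := d) _ v) => [|i x]; last first.
    by rewrite d_level F_invariant.
  rewrite /hits big_allpairs_dep big_enum; apply: eq_bigr => k _.
  by rewrite /F /index_iota subn0; apply: eq_bigr => i _; rewrite addrA.
apply: eq_bigr => k _; rewrite -[RHS]/(F (cell k)).
by rewrite /cell -mulrNz F_invariant.
Qed.

Lemma avoiding_density_ge_mean_card (c : seq {set I}) :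
  c != [::] -> cycle (state_step (range d) cell t) c ->
  avoiding_density_ge d (mean_card c / #|{: I}|%:R).
Proof.
move=> c_neq0 cycle_c; set p := size c.
have p_gt0 : (0 < p)%N by rewrite lt0n size_eq0.
have card_gt0 : (0 < #|{: I}|)%N by rewrite card_ffun !card_ord expn_gt0 N_gt0.
pose sig z := nth (finset.set0 : {set I}) c `|(z %% p)%Z|.
have step_sig z : state_step (range d) cell t (sig z) (sig (z + 1)).
  by apply: cycle_nth_modz => //; exact/eqP.
have sigp z : sig (z + p%:Z) = sig z by rewrite /sig modzDr.
pose P := glued cell t sig.
exists P, (box_progression p); split.
- exact: avoiding_glued step_sig cell_local.
- by rewrite -size_eq0 size_box_progression -lt0n muln_gt0 card_gt0.
move=> v.
have -> : hits P (box_progression p) (comb d v) = (\sum_(s <- c) #|s|)%N.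
  rewrite hits_box_progression; last exact: glued_periodic sigp.
  rewrite [RHS](big_nth finset.set0); apply: eq_big_nat => i /andP[_ i_lt].
  rewrite -sum1_card [RHS]big_mkcond; apply: eq_bigr => k _.
  rewrite pmulrn (mem_glued step_sig cell_block_inj).
  by rewrite /sig modz_nat absz_nat modn_small.
rewrite size_box_progression natrM /mean_card /mean_weight -natr_sum -/p.
rewrite le_eqVlt; apply/orP; left; apply/eqP.
by field; rewrite !pnatr_eq0 -!lt0n p_gt0 card_gt0.
Qed.

Lemma avoiding_density_virtually_cyclic : exists q, avoiding_density d q.
Proof.
have card_gt0 : (0 < #|{: I}|)%N by rewrite card_ffun !card_ord expn_gt0 N_gt0.
have [c [c_neq0 cycle_c density_le]] :=
  avoiding_density_le_mean_card (range d) cell t card_gt0.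
exists (mean_card c / #|{: I}|%:R); split=> //.
exact: avoiding_density_ge_mean_card cycle_c.
Qed.
End VirtuallyCyclic.

(** * At most three generators *)

Lemma avoiding_density_commensurable (G : zmodType) n (d : 'I_n -> G) (t : G)
    (m : nat) (a : 'I_n -> int) :
  (0 < m)%N -> (forall i, d i *+ m = t *~ a i) ->
  exists q, avoiding_density d q.
Proof.
move=> m_gt0 dm.
have [[z z_neq0 tz0]|t_free] := pselect (exists2 z : int, z != 0 & t *~ z = 0).
  apply: (avoiding_density_torsion (N := m * `|z|%N)) => [|i].
    by rewrite muln_gt0 m_gt0 absz_gt0.
  rewrite mulrnA dm pmulrn mulrzAC abszEsg [sgz z * z]mulrC mulrzA tz0.
  by rewrite !mul0rz.
pose M := (\sum_i `|a i|)%N.+1.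
apply: (@avoiding_density_virtually_cyclic _ _ (m * M)%N d a (t *+ M)) => //.
- by rewrite muln_gt0 m_gt0.
- move=> z; rewrite pmulrn -mulrzA => tMz0; apply/eqP/negP => /negP z_neq0.
  by apply: t_free; exists (M%:Z * z); rewrite ?mulf_neq0.
- by move=> i; rewrite mulrnA dm !pmulrn mulrzAC.
- move=> i; rewrite -abszE lez_nat (@leq_trans M) ?leq_pmull //.
  by rewrite /M (bigD1 i) //= leqW ?leq_addr.
Qed.

Lemma eliminated_term_multiple (G : zmodType) n (d : 'I_n -> G) (t : G)
    u v i j :
  comb d u = 0 -> comb d v = 0 ->
  (forall k, k != i -> k != j -> exists b, d k = t *~ b) ->
  exists a, d i *~ (u 0 i * v 0 j - u 0 j * v 0 i) = t *~ a.
Proof.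
move=> u_rel v_rel multiples; pose w := v 0 j *: u - u 0 j *: v.
have w_rel : comb d w = 0.
  by rewrite raddfB /= !combZ u_rel v_rel !mul0rz subrr.
have wi : w 0 i = u 0 i * v 0 j - u 0 j * v 0 i by rewrite !mxE; ring.
have wj : w 0 j = 0 by rewrite !mxE; ring.
have [b sum_eq] : exists b, \sum_(k | k != i) d k *~ w 0 k = t *~ b.
  elim/big_ind: _ => [|_ _ [b ->] [b' ->]|k ki].
  - by exists 0; rewrite mulr0z.
  - by exists (b + b'); rewrite mulrzDr.
  - have [->|kj] := eqVneq k j; first by exists 0; rewrite wj.
    by have [b ->] := multiples k ki kj; exists (b * w 0 k); rewrite mulrzA.
exists (- b); rewrite mulrNz -sum_eq -wi; apply/eqP; rewrite -addr_eq0.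
by move: w_rel; rewrite /comb (bigD1 i) //= => ->.
Qed.

Lemma avoiding_density_two_relations (G : zmodType) n (d : 'I_n -> G) (t : G)
    u v i j :
  comb d u = 0 -> comb d v = 0 -> u 0 i * v 0 j <> u 0 j * v 0 i ->
  (forall k, k != i -> k != j -> exists b, d k = t *~ b) ->
  exists q, avoiding_density d q.
Proof.
move=> u_rel v_rel uv_minor multiples.
pose m := u 0 i * v 0 j - u 0 j * v 0 i.
have /choice[a dm] : forall k, exists a, d k *~ m = t *~ a.
  move=> k; have [->|ki] := eqVneq k i; first exact: eliminated_term_multiple.
  have [->|kj] := eqVneq k j; last first.
    by have [b ->] := multiples k ki kj; exists (b * m); rewrite mulrzA.
  have [|a dj] := @eliminated_term_multiple _ _ d t v u j i v_rel u_rel.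
    by move=> l lj li; exact: multiples.
  by exists a; rewrite -dj; congr (_ *~ _); rewrite /m; ring.
apply: (@avoiding_density_commensurable _ _ d t `|m|%N (fun k => a k * sgz m)).
  by rewrite absz_gt0 subr_eq0; exact/eqP.
by move=> k; rewrite pmulrn abszEsg [sgz m * m]mulrC !mulrzA dm.
Qed.

Lemma exists_avoiding_density_le3 (G : zmodType) n (d : 'I_n -> G) :
  (n <= 3)%N -> (forall i, d i != 0) -> exists q, avoiding_density d q.
Proof.
case: n d => [|n] d n_le3 d_neq0.
  by apply: (avoiding_density_torsion (N := 1)) => // -[].
have [|] := pselect (forall u v, comb d u = 0 -> comb d v = 0 -> parallel u v).
  exact: avoiding_density_parallel.
move=> /existsNP[u /existsNP[v /not_implyP[u_rel /not_implyP[v_rel]]]].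
move=> /existsNP[i /existsNP[j uv_minor]].
pose t := if [pick k | (k != i) && (k != j)] is Some k then d k else 0.
apply: (avoiding_density_two_relations (t := t) u_rel v_rel uv_minor).
move=> k ki kj; exists 1; rewrite mulr1z /t.
case: pickP => [l /andP[li lj]|/(_ k)]; last first.
  by rewrite ki kj.
have ij : i != j by apply/eqP => ij; rewrite ij in uv_minor.
congr d; apply/eqP/negPn/negP => kl.
have : (size [:: i; j; k; l] <= #|'I_n.+1|)%N.
  rewrite -(card_uniqP _) ?max_card //= !inE !negb_or ij kl.
  by rewrite ![_ == k]eq_sym ![_ == l]eq_sym ki kj li lj.
by rewrite card_ord => /leq_trans/(_ n_le3).
Qed.

(** * Haar measure and translates *)

Section Volume.
Context d (T : measurableType d) (R : realType) (mu : probability T R).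
Implicit Types A B : set T.

Definition vol A : R := fine (mu A).

Lemma volE A : measurable A -> mu A = (vol A)%:E.
Proof. by move=> mA; rewrite fineK // fin_num_measure. Qed.

Lemma vol_ge0 A : 0 <= vol A.
Proof. by rewrite fine_ge0. Qed.

Lemma le_vol A B : measurable A -> measurable B -> A `<=` B -> vol A <= vol B.
Proof.
by move=> mA mB AB; rewrite -lee_fin -!volE //; apply: le_measure; rewrite ?inE.
Qed.

Lemma vol_setT : vol setT = 1.
Proof. by rewrite /vol probability_setT. Qed.

Lemma vol_set0 : vol set0 = 0.
Proof. by rewrite /vol measure0. Qed.

Lemma volU A B : measurable A -> measurable B -> [disjoint A & B] ->
  vol (A `|` B) = vol A + vol B.
Proof.
move=> mA mB AB0; apply: EFin_inj; rewrite EFinD -!volE //.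
  by rewrite measureU //; apply/disj_set2P.
exact: measurableU.
Qed.

Lemma volD A B : measurable A -> measurable B -> B `<=` A ->
  vol (A `\` B) = vol A - vol B.
Proof.
move=> mA mB BA; rewrite -[in RHS](setDUK BA) volU //.
- by rewrite addrC addKr.
- exact: measurableD.
- by apply/disj_setPLR => x Bx [].
Qed.

Lemma vol_bigcup_seq (I : choiceType) (s : seq I) (F : I -> set T) :
  uniq s -> (forall i, measurable (F i)) -> trivIset [set` s] F ->
  vol (\bigcup_(i in [set` s]) F i) = \sum_(i <- s) vol (F i).
Proof.
move=> uniq_s mF disjF; rewrite /vol measure_fin_bigcup //.
by rewrite -fsbig_seq // sum_fine // => i _; rewrite fin_num_measure.
Qed.
End Volume.

Definition disjoint_translates (G : zmodType) (B : seq G) (C : set G) : Prop :=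
  trivIset [set` B] (fun b : G => translate b C).

Section Translation.
Variable G : topologicalZmodType.

Lemma open_translate (x : G) (A : set G) : open A -> open (translate x A).
Proof.
move=> oA; apply: open_comp oA => y _.
apply: (@continuous2_cvg _ _ _ _ _ _ _ _ (fun a b : G => a - b)).
- exact: (@sub_continuous G (y, x)).
- exact: cvg_id.
- exact: cvg_cst.
Qed.

Lemma finite_cover_translates (V : set G) :
  compact [set: G] -> open V -> V 0 ->
  exists xs : seq G, forall y, exists2 x, x \in xs & translate x V y.
Proof.
pose pG : ptopologicalType := HB.pack G (isPointed.Build G 0).
move=> cG oV V0; have := cG; rewrite (compact_cover pG : @compact G = _).
move=> /(_ G setT (fun x => translate x V)) [].
- by move=> x _; exact: open_translate.
- by move=> y _; exists y => //=; rewrite /translate /= subrr.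
move=> xs _ cov; exists (finmap.enum_fset xs) => y.
by have [x] := cov y I; exists x.
Qed.

Lemma open_cover_disjoint_translates (B : seq G) :
  hausdorff_space G -> compact [set: G] ->
  exists Cs : seq (set G), (forall y, exists2 C, C \in Cs & C y) /\
    forall C, C \in Cs -> open C /\ disjoint_translates B C.
Proof.
move=> hG cG.
pose diffs := [seq f <- [seq b - b' | b <- B, b' <- B] | f != 0].
have diffs_closed : closed [set f | f \in diffs].
  apply: (accessible_finite_set_closed.1 (hausdorff_accessible hG)).
  exact: finite_seq.
have nbhs_diffsC : nbhs (0 - 0 : G) (~` [set f | f \in diffs]).
  apply: open_nbhs_nbhs; split; first exact: closed_openC.
  by rewrite subrr /= mem_filter eqxx.
have [[U1 U2] /= [nbhs_U1 nbhs_U2] subU] :=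
  @sub_continuous G (0, 0) _ nbhs_diffsC.
pose V := (U1 `&` U2)^°.
have V0 : V 0 by exact: filterI.
have [xs cover_xs] := finite_cover_translates cG (@open_interior _ _) V0.
exists [seq translate x V | x <- xs]; split.
  move=> y; have [x x_xs Vx] := cover_xs y.
  by exists (translate x V) => //; exact: map_f.
move=> _ /mapP[z _ ->]; split; first exact/open_translate/open_interior.
move=> b b' bB b'B [y [/interior_subset[/= _ Vb] /interior_subset[/= Vb' _]]].
have := subU (y - b' - z, y - b - z) (conj Vb' Vb); rewrite /=.
have -> : y - b' - z - (y - b - z) = b - b'.
  by rewrite opprB addrA subrK opprB addrC addrA subrK.
rewrite mem_filter => /negP; rewrite negb_and negbK.
by case/orP=> [/eqP/subr0_eq//|/negP[]]; exact: allpairs_f.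
Qed.
End Translation.

Local Notation borel_set A := (measurable (A : set (borel _))).

Section Haar.
Variables (G : topologicalZmodType) (R : realType).
Variable mu : probability (borel G) R.
Hypothesis haar : is_haar_prob mu.
Implicit Types A : set G.

Lemma open_borel A : open A -> borel_set A.
Proof. by move=> oA; exact: sub_sigma_algebra. Qed.

Lemma measurable_translate (x : G) A :
  borel_set A -> borel_set (translate x A).
Proof.
move=> mA.
have m_sub : measurable_fun setT ((fun y => y - x) : borel G -> borel G).
  apply: (@measurability _ _ (borel G) (borel G) setT _ (@open G)) => //.
  move=> _ [U oU <-]; rewrite setTI; apply: open_borel; exact: open_translate.
by have := m_sub measurableT _ mA; rewrite setTI.
Qed.

Lemma vol_translate (x : G) A : borel_set A ->
  vol mu (translate x A) = vol mu A.
Proof.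
move=> mA; rewrite /vol -(haar.1 x A mA); congr (fine (mu _)).
apply/seteqP; split=> [y Ay|_ [z Az <-]].
  by exists (y - x) => //; rewrite addrC subrK.
by rewrite /translate /= addrC addKr.
Qed.

Lemma vol_le_of_hits (gs : seq G) (M : R) A : borel_set A ->
  (forall x, (hits A gs x)%:R <= M) -> vol mu A * (size gs)%:R <= M.
Proof.
move=> mA hits_le.
have m_translate g := measurable_translate (- g) mA.
pose f g (x : borel G) : \bar R := (\1_(translate (- g) A) x)%:E.
have mf g : measurable_fun setT (f g).
  by apply/measurable_EFinP; exact: measurable_indic.
have f_ge0 g x : setT x -> (0 <= f g x)%E by move=> _; rewrite lee_fin.
have int_f g : (\int[mu]_x f g x = (vol mu A)%:E)%E.
  by rewrite integral_indic // setIT -(vol_translate (- g) mA); exact: volE.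
have int_sum :
    (\int[mu]_x (\sum_(g <- gs) f g x) = (vol mu A * (size gs)%:R)%:E)%E.
  rewrite ge0_integral_sum //; under eq_bigr do rewrite int_f.
  by rewrite sumEFin sumr_const_seq mulr_natr.
have int_cst : (\int[mu]_x (cst M%:E x) = M%:E)%E.
  by rewrite integral_cst // -[RHS]mule1 -(probability_setT mu).
rewrite -lee_fin -int_sum -int_cst; apply: ge0_le_integral => //.
- by move=> x _; apply: sume_ge0 => g _; exact: f_ge0.
- by apply: emeasurable_sum => g; exact: mf.
- move=> x _; rewrite sumEFin lee_fin (le_trans _ (hits_le x)) //.
  rewrite natr_sum; apply: ler_sum => g _.
  by rewrite indicE mem_translate opprK.
Qed.
End Haar.

(** * Balls of polynomial growth *)

Lemma bernoulli_le (R : realDomainType) (e : R) n : 0 <= e ->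
  1 + e *+ n <= (1 + e) ^+ n.
Proof.
move=> e_ge0; elim: n => [|n IH]; first by rewrite expr0 mulr0n addr0.
rewrite exprS (le_trans _ (ler_wpM2l _ IH)) ?addr_ge0 //.
have := mulr_ge0 e_ge0 (mulrn_wge0 n e_ge0).
by rewrite mulrS; move: (e *+ n) => t; lra.
Qed.

Lemma odd_power_le_exponential (R : archiRealFieldType) (e : R) k : 0 < e ->
  exists2 n, (0 < n)%N & ((2 * n).+1 ^ k)%:R <= (1 + e) ^+ n.
Proof.
move=> e_gt0; pose a := (2 * k.+1).+1; pose x : R := a%:R ^+ k / e ^+ k.+1.
have x_ge0 : 0 <= x by rewrite divr_ge0 // ?exprn_ge0 // ltW.
pose m := (Num.bound x).+1; exists (m * k.+1)%N; first by rewrite muln_gt0.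
have xm : x <= m%:R by rewrite (le_trans (ltW (archi_boundP x_ge0))) ?ler_nat.
have odd_le : ((2 * (m * k.+1)).+1 <= a * m)%N by rewrite /a /m; nia.
apply: (@le_trans _ _ (a%:R ^+ k * m%:R ^+ k)).
  by rewrite -exprMn -natrM natrX lerXn2r ?nnegrE ?ler_nat.
apply: (@le_trans _ _ ((e * m%:R) ^+ k.+1)).
  rewrite exprMn [m%:R ^+ k.+1]exprS mulrA ler_wpM2r ?exprn_ge0 //.
  by move: xm; rewrite /x ler_pdivrMr ?exprn_gt0 // mulrC.
rewrite exprM lerXn2r ?nnegrE ?exprn_ge0 ?addr_ge0 ?mulr_ge0 ?(ltW e_gt0) //.
by rewrite (le_trans _ (bernoulli_le m (ltW e_gt0))) // mulr_natr lerDr.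
Qed.

Definition thickens (G : zmodType) (D : set G) (B B' : seq G) : Prop :=
  forall b x, b \in B -> D x -> (b + x \in B') /\ (b - x \in B').

Section Balls.
Variables (G : zmodType) (n : nat) (d : 'I_n -> G).

Definition comb_ball (r : nat) : seq G :=
  undup [seq comb d (cube_point k - const_mx r%:Z) |
         k : {ffun 'I_n -> 'I_(2 * r).+1}].

Lemma comb_ballP r x : reflect
  (exists2 v : 'rV_n, (forall i, `|v 0 i| <= r%:Z) & x = comb d v)
  (x \in comb_ball r).
Proof.
rewrite mem_undup; apply: (iffP codomP) => [[k ->]|[v v_le ->]].
  exists (cube_point k - const_mx r%:Z) => // i.
  by rewrite !mxE; case: (k i) => j j_lt /=; lia.
exists [ffun i => inord `|(v 0 i + r%:Z)%R|%N] => //; congr (comb d _).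
apply/rowP => i; rewrite !mxE ffunE; move: (v 0 i) (v_le i) => z z_le.
by rewrite inordK; lia.
Qed.

Lemma size_comb_ball_le r : (size (comb_ball r) <= (2 * r).+1 ^ n)%N.
Proof.
by rewrite (leq_trans (size_undup _)) // size_image card_ffun !card_ord.
Qed.

Lemma comb_ball0 r : 0 \in comb_ball r.
Proof.
by apply/comb_ballP; exists 0; rewrite ?raddf0 // => i; rewrite mxE normr0.
Qed.

Lemma comb_ball_subset r r' :
  (r <= r')%N -> {subset comb_ball r <= comb_ball r'}.
Proof.
move=> rr' x /comb_ballP[v v_le ->]; apply/comb_ballP; exists v => // i.
by rewrite (le_trans (v_le i)) ?lez_nat.
Qed.

Lemma comb_ball_thickens r :
  thickens (range d) (comb_ball r) (comb_ball r.+1).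
Proof.
move=> _ _ /comb_ballP[v v_le ->] [i _ <-].
rewrite -(comb_delta d i) -raddfD -raddfB.
by split; apply/comb_ballP; eexists=> // j; rewrite !mxE;
  move: (v 0 j) (v_le j) => z; case: (_ && _); lia.
Qed.
End Balls.

(** * Region growing *)

Lemma exists_ge_average (R : realDomainType) (I : eqType) (s : seq I)
    (f : I -> R) (K : R) :
  s != [::] -> K *+ size s <= \sum_(i <- s) f i ->
  exists2 i, i \in s & K <= f i.
Proof.
move=> s_neq0; apply: contraPP => /forall2NP lt_K; apply/negP; rewrite -ltNge.
rewrite -sumr_const_seq big_seq [ltRHS]big_seq; apply: ltr_sum => [|i si].
  by apply/hasP; case: (s) s_neq0 => // i l _; exists i; rewrite mem_head.
by rewrite ltNge; apply/negP; case: (lt_K i).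
Qed.

Lemma exists_slow_step (R : realDomainType) (V : nat -> R) (a : R) n :
  0 < a -> (0 < n)%N -> V n <= a ^+ n * V 0%N ->
  exists2 r, (r < n)%N & V r.+1 <= a * V r.
Proof.
move=> a_gt0 n_gt0; apply: contraPP => /forall2NP fast.
apply/negP; rewrite -ltNge.
have step r : (r < n)%N -> a * V r < V r.+1.
  by move=> r_lt; rewrite ltNge; apply/negP; case: (fast r).
have grow r : (r < n)%N -> a ^+ r.+1 * V 0%N < V r.+1.
  elim: r => [|r IH] r_lt; first by rewrite expr1 step.
  by rewrite exprS -mulrA (lt_trans _ (step _ r_lt)) ?ltr_pM2l ?IH // ltnW.
by case: n n_gt0 {fast step} grow => // n _; exact.
Qed.

Definition unlinked (G : zmodType) (D A A' : set G) : Prop :=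
  forall a a', A a -> A' a' -> ~ D (a - a') /\ ~ D (a' - a).

Lemma avoidingU (G : zmodType) (D A A' : set G) :
  avoiding D A -> avoiding D A' -> unlinked D A A' -> avoiding D (A `|` A').
Proof.
move=> avA avA' AA' a b [Aa|Aa] [Ab|Ab].
- exact: avA.
- exact: (AA' _ _ Aa Ab).1.
- exact: (AA' _ _ Ab Aa).2.
- exact: avA'.
Qed.

Section Sweep.
Variables (G : topologicalZmodType) (R : realType).
Variable mu : probability (borel G) R.
Hypothesis haar : is_haar_prob mu.
Variables (D C Y : set G).
Hypothesis mC : borel_set C.
Hypothesis mY : borel_set Y.
Implicit Types (B : seq G) (P : set G).

Definition piece b : set G := translate b (C `&` Y) `&` Y.

Definition sweep B : set G := \bigcup_(b in [set` B]) piece b.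

Lemma measurable_piece b : borel_set (piece b).
Proof.
by apply: measurableI => //; apply: measurable_translate; exact: measurableI.
Qed.

Lemma measurable_sweep B : borel_set (sweep B).
Proof.
by apply: fin_bigcup_measurable => // b _; exact: measurable_piece.
Qed.

Lemma vol_piece_le b : vol mu (piece b) <= vol mu (C `&` Y).
Proof.
have mCY : borel_set (C `&` Y) by exact: measurableI.
rewrite -(vol_translate haar b mCY); apply: le_vol => [||x []//].
  exact: measurable_piece.
exact: measurable_translate.
Qed.

Lemma sweep_subset B B' : {subset B <= B'} -> sweep B `<=` sweep B'.
Proof. by move=> BB' x [b /BB'] ; exists b. Qed.

Lemma sub_sweep B : 0 \in B -> C `&` Y `<=` sweep B.
Proof.
by move=> B0 x [Cx Yx]; exists 0 => //; split=> //; split; rewrite subr0.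
Qed.

Lemma sweep_sub B : sweep B `<=` Y.
Proof. by move=> x [b _ []]. Qed.

Lemma vol_sweep B : uniq B -> disjoint_translates B C ->
  vol mu (sweep B) = \sum_(b <- B) vol mu (piece b).
Proof.
move=> uniq_B disjB; apply: vol_bigcup_seq => //; first exact: measurable_piece.
move=> b b' bB b'B [x [[[Cx _] _] [[Cx' _] _]]].
by apply: disjB => //; exists x.
Qed.

Lemma unlinked_sweep B B' : thickens D B B' ->
  unlinked D (sweep B) (Y `\` sweep B').
Proof.
move=> BB' x y [b bB [CYx _]] [Yy nBy]; split=> Dxy; apply: nBy.
  exists (b - (x - y)); first exact: (BB' _ _ bB Dxy).2.
  suff E : y - (b - (x - y)) = x - b by split=> //; rewrite /translate /= E.
  by rewrite (opprB b) addrA [y + _]addrC subrK.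
exists (b + (y - x)); first exact: (BB' _ _ bB Dxy).1.
suff E : y - (b + (y - x)) = x - b by split=> //; rewrite /translate /= E.
by rewrite opprD opprB addrC addrA subrK addrC.
Qed.

Definition fill P B g : set G := sweep [seq b <- B | b + g \in P].

Lemma fill_sub_sweep P B g : fill P B g `<=` sweep B.
Proof. by apply: sweep_subset => b; rewrite mem_filter => /andP[]. Qed.

Lemma avoiding_fill P B B' g : avoiding D P -> {subset B <= B'} ->
  thickens D B B' -> disjoint_translates B' C -> avoiding D (fill P B g).
Proof.
move=> avP subB BB' disjB x y.
move=> [b /= + [[Cx _] _]] [b' /= + [[Cy _] _]] Dxy; rewrite !mem_filter.
move=> /andP[/set_mem Pb bB] /andP[/set_mem Pb' b'B]; apply: (avP _ _ Pb Pb').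
have bE : b = b' + (x - y).
  apply: disjB; first exact: subB.
    exact: (BB' _ _ b'B Dxy).1.
  exists x; split=> //.
  by rewrite /translate /= opprD opprB addrA addrC addrA subrK.
by rewrite bE opprD addrACA subrr addr0 addrAC subrr add0r.
Qed.

Lemma exists_dense_fill (q : R) P (gs B : seq G) :
  gs != [::] -> (forall b, b \in B -> q * (size gs)%:R <= (hits P gs b)%:R) ->
  uniq B -> disjoint_translates B C ->
  exists g, q * vol mu (sweep B) <= vol mu (fill P B g).
Proof.
move=> gs_neq0 hits_ge uniq_B disjB.
have vol_fill g : vol mu (fill P B g) =
    \sum_(b <- B) (b + g \in P)%:R * vol mu (piece b).
  rewrite vol_sweep ?filter_uniq // => [|b b']; last first.
    by rewrite /= !mem_filter => /andP[_ bB] /andP[_ b'B]; exact: disjB.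
  rewrite big_filter big_mkcond; apply: eq_bigr => b _.
  by case: (b + g \in P); rewrite ?mul1r ?mul0r.
suff [g _ g_ge] :
    exists2 g, g \in gs & q * vol mu (sweep B) <= vol mu (fill P B g).
  by exists g.
apply: exists_ge_average => //; under eq_bigr do rewrite vol_fill.
rewrite exchange_big vol_sweep // mulr_sumr -sumrMnl big_seq [leRHS]big_seq.
apply: ler_sum => b bB; rewrite -mulr_suml -natr_sum -[leLHS]mulr_natr mulrAC.
by rewrite ler_wpM2r ?vol_ge0 ?hits_ge.
Qed.
End Sweep.

Section RegionGrowing.
Variables (G : topologicalZmodType) (R : realType).
Variable mu : probability (borel G) R.
Hypothesis haar : is_haar_prob mu.
Variables (n : nat) (d : 'I_n -> G) (P : set G) (gs : seq G) (q e : R).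
Variable m : nat.
Hypothesis avP : avoiding (range d) P.
Hypothesis gs_neq0 : gs != [::].
Hypothesis q_ge0 : 0 <= q.
Hypothesis hits_ge : forall v, q * (size gs)%:R <= (hits P gs (comb d v))%:R.
Hypothesis e_gt0 : 0 < e.
Hypothesis m_gt0 : (0 < m)%N.
Hypothesis ball_growth : (size (comb_ball d m))%:R <= (1 + e) ^+ m.

Lemma exists_slow_sweep (C Y : set G) :
  borel_set C -> borel_set Y ->
  disjoint_translates (comb_ball d m) C ->
  exists2 r, (r < m)%N & vol mu (sweep C Y (comb_ball d r.+1)) <=
    (1 + e) * vol mu (sweep C Y (comb_ball d r)).
Proof.
move=> mC mY disjC.
pose V r := vol mu (sweep C Y (comb_ball d r)).
apply: (exists_slow_step (V := V)) => //; rewrite /V.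
  by rewrite addr_gt0.
have mCY : borel_set (C `&` Y) by exact: measurableI.
apply: (@le_trans _ _ ((size (comb_ball d m))%:R * vol mu (C `&` Y))).
  rewrite vol_sweep ?undup_uniq // mulrC mulr_natr -sumr_const_seq.
  by apply: ler_sum => b _; exact: vol_piece_le.
apply: ler_pM; rewrite ?ler0n ?vol_ge0 //; apply: le_vol => //.
  exact: measurable_sweep.
by apply: sub_sweep; exact: comb_ball0.
Qed.

Lemma exists_avoiding_carving (C Y : set G) :
  borel_set C -> borel_set Y ->
  disjoint_translates (comb_ball d m) C ->
  exists A Y', [/\ borel_set A, borel_set Y',
    A `<=` Y `\` Y' /\ Y' `<=` Y `\` C,
    avoiding (range d) A /\ unlinked (range d) A Y' &
    q * (vol mu Y - vol mu Y') <= (1 + e) * vol mu A].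
Proof.
move=> mC mY disjC.
have [r r_lt slow] := exists_slow_sweep mC mY disjC.
set B := comb_ball d r in slow; set B' := comb_ball d r.+1 in slow.
have subB : {subset B <= B'} by exact/comb_ball_subset/leqnSn.
have disj_r k : (k <= m)%N -> disjoint_translates (comb_ball d k) C.
  by move=> k_le; apply: sub_trivIset disjC => b; exact: comb_ball_subset.
have BB' : thickens (range d) B B' by exact: comb_ball_thickens.
have [g g_ge] : exists g,
    q * vol mu (sweep C Y B) <= vol mu (fill C Y P B g).
  apply: (exists_dense_fill mu mC mY gs_neq0 _ (undup_uniq _)).
    by move=> _ /comb_ballP[v _ ->].
  exact/disj_r/ltnW.
have m_sweep B0 : borel_set (sweep C Y B0) by exact: measurable_sweep.
have fill_sub := @fill_sub_sweep G C Y P B g.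
exists (fill C Y P B g), (Y `\` sweep C Y B'); split.
- exact: m_sweep.
- exact: measurableD.
- split=> x.
    move=> /fill_sub x_sweep; split; first exact: sweep_sub x_sweep.
    by case=> _; apply; apply: sweep_subset x_sweep.
  case=> Yx nx_sweep; split=> // Cx; apply: nx_sweep.
  by apply: sub_sweep; first exact: comb_ball0.
- split; first exact: avoiding_fill avP subB BB' (disj_r _ r_lt).
  by move=> a y /fill_sub; exact: unlinked_sweep.
rewrite volD //; last exact: sweep_sub.
rewrite subKr (le_trans (ler_wpM2l q_ge0 slow)) // mulrCA ler_wpM2l //.
by rewrite addr_ge0 // ltW.
Qed.

Lemma exists_dense_avoiding_of_cover (Cs : seq (set G)) (Y : set G) :
  (forall C, C \in Cs -> borel_set C /\
    disjoint_translates (comb_ball d m) C) ->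
  borel_set Y ->
  (forall y, Y y -> exists2 C, C \in Cs & C y) ->
  exists A, [/\ borel_set A, A `<=` Y,
    avoiding (range d) A & q * vol mu Y <= (1 + e) * vol mu A].
Proof.
elim: Cs Y => [|C Cs IH] Y CsP mY coverY.
  exists set0; split=> //.
  suff -> : Y = set0 by rewrite vol_set0 !mulr0.
  by apply/seteqP; split=> y // /coverY[].
have [mC disjC] := CsP C (mem_head _ _).
have [A [Y' [mA mY' [AY Y'Y] [avA AY'] A_ge]]] :=
  exists_avoiding_carving mC mY disjC.
have [|y Y'y|A' [mA' A'Y' avA' A'_ge]] := IH Y' _ mY'.
- by move=> C' C'Cs; apply: CsP; rewrite inE C'Cs orbT.
- have [Yy nCy] := Y'Y _ Y'y; have [C' + C'y] := coverY _ Yy.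
  by rewrite inE => /predU1P[E|C'Cs]; [rewrite E in C'y|exists C'].
exists (A `|` A'); split.
- exact: measurableU.
- by move=> x [/AY[]|/A'Y'/Y'Y[]].
- by apply: avoidingU => // a a' Aa A'a'; apply: AY' => //; exact: A'Y'.
- rewrite volU //; first by rewrite mulrDr; lra.
  by apply/disj_setPLR => x /AY[_ nY'x] /A'Y'.
Qed.
End RegionGrowing.

(** * The Motzkin density *)

Section MotzkinDensity.
Variables (G : topologicalZmodType) (R : realType).
Variable mu : probability (borel G) R.
Hypothesis haus : hausdorff_space G.
Hypothesis comp : compact [set: G].
Hypothesis haar : is_haar_prob mu.

Lemma vol_le_avoiding_density (D A : set G) (q : rat) :
  avoiding_density_le D q -> borel_set A -> avoiding D A ->
  vol mu A <= ratr q.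
Proof.
move=> density_le mA avA; rewrite leNgt; apply/negP => /rat_in_itvoo[r].
rewrite in_itv /= => /andP[qr]; apply/negP; rewrite -leNgt.
have [|gs gs_neq0 hits_le] := density_le (r - q).
  by rewrite subr_gt0 -(ltr_rat R).
have size_gt0 : 0 < (size gs)%:R :> R by rewrite ltr0n lt0n size_eq0.
rewrite -(ler_pM2r size_gt0); apply: (vol_le_of_hits haar) => // x.
have := hits_le A x avA; rewrite [q + _]addrC subrK -(ler_rat R).
by rewrite rmorphM /= !ratr_nat.
Qed.

Lemma exists_dense_avoiding n (d : 'I_n -> G) (q : rat) (e : R) :
  avoiding_density_ge d q -> 0 < e ->
  exists A, [/\ borel_set A, avoiding (range d) A &
    ratr q <= vol mu A + e].
Proof.
move=> [P [gs [avP gs_neq0 hits_ge]]] e_gt0.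
have [q_ge0|q_lt0] := leP 0 q; last first.
  exists set0; split=> //.
  by rewrite vol_set0 add0r (le_trans _ (ltW e_gt0)) // lerq0 ltW.
have [m m_gt0 growth] := odd_power_le_exponential n e_gt0.
have [Cs [coverCs CsP]] :=
  open_cover_disjoint_translates (comb_ball d m) haus comp.
have ratr_q_ge0 : 0 <= ratr q :> R by rewrite ler0q.
have ratr_hits_ge v : ratr q * (size gs)%:R <= (hits P gs (comb d v))%:R :> R.
  by rewrite -!(ratr_nat R) -rmorphM ler_rat.
have ball_growth : (size (comb_ball d m))%:R <= (1 + e) ^+ m.
  by rewrite (le_trans _ growth) // ler_nat size_comb_ball_le.
have [C /CsP[openC disjC]|//|y _|A [mA _ avA]] := exists_dense_avoiding_of_cover
    haar avP gs_neq0 ratr_q_ge0 ratr_hits_ge e_gt0 m_gt0 ball_growth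
    (Cs := Cs) (Y := setT).
- by split; [exact: open_borel|].
- exact: coverCs.
rewrite vol_setT mulr1 => A_ge; exists A; split=> //; apply: le_trans A_ge _.
have A_le1 : vol mu A <= 1 by rewrite -(vol_setT mu); exact: le_vol.
by rewrite mulrDl mul1r lerD2l ger_pMr.
Qed.

Lemma motzkin_density_avoiding_density n (d : 'I_n -> G) (q : rat) :
  avoiding_density d q -> motzkin_density mu (range d) = (ratr q)%:E.
Proof.
move=> [density_ge density_le]; apply/eqP; rewrite eq_le; apply/andP; split.
  apply: ge_ereal_sup => _ [A [mA avA] <-].
  by rewrite volE // lee_fin (vol_le_avoiding_density density_le).
apply/lee_addgt0Pr => e e_gt0.
have [A [mA avA A_ge]] := exists_dense_avoiding density_ge e_gt0.
apply: (@le_trans _ _ (mu A + e%:E)%E); first by rewrite volE // -EFinD lee_fin.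
by rewrite leeD2r //; apply: ereal_sup_ubound; exists A.
Qed.
End MotzkinDensity.

Theorem theorem1p1 (G : topologicalZmodType) (R : realType)
  (mu : probability (borel G) R) (D : set G) :
  hausdorff_space G -> compact [set: G] -> is_haar_prob mu ->
  (exists s : seq G, (size s <= 3)%N /\ D = [set x | x \in s]) ->
  ~ D 0 ->
  exists q : rat, motzkin_density mu D = (ratr q)%:E.
Proof.
move=> haus comp haar [s [size_s DE]] D0.
pose d : 'I_(size s) -> G := tnth (in_tuple s).
have D_range : D = range d.
  rewrite DE; apply/seteqP; split=> [x /(tnthP (in_tuple s))[i ->]|_ [i _ <-]].
    by exists i.
  exact: mem_tnth.
have d_neq0 i : d i != 0.
  by apply/eqP => di0; apply: D0; rewrite D_range; exists i.
have [q density_q] := exists_avoiding_density_le3 size_s d_neq0.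
by exists q; rewrite D_range; exact: motzkin_density_avoiding_density.
Qed.
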